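(* Let $X$ be a subshift. If there exists a positive integer $n$ such that $|F_X(n)| \leq \log_2(n+1)$, then $X$ is sofic.
   Context: Let $A$ be a finite set (the alphabet). A subshift on $A$ is a shift-invariant subset $X$ of $A^{\mathbb{Z}}$ that is closed in the product topology. The language $L(X)$ is the set of all finite words which appear in points of $X$, and $L_n(X) = L(X)\cap A^n$. For $w \in L(X)$, the follower set $F_X(w)$ is the set of all right-infinite sequences $s \in A^{\mathbb{N}}$ such that the infinite word $ws$ occurs in some point of $X$. For a positive integer $n$, $F_X(n) = \{F_X(w) : w \in L_n(X)\}$ (a set of sets), so $|F_X(n)|$ is the number of distinct follower sets of words of length $n$ in $X$. A subshift is sofic if it is the image of a shift of finite type under a continuous shift-commuting map; equivalently, if $\{F_X(w) : w \in L(X)\}$ is finite. *)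

(* Defs.v *)
From HB Require Import structures.
From mathcomp Require Import all_boot all_order all_algebra.
From mathcomp Require Import all_classical all_reals all_analysis.

Set Implicit Arguments.
Unset Strict Implicit.
Unset Printing Implicit Defensive.

Import Order.TTheory GRing.Theory Num.Theory.
Local Open Scope classical_set_scope.
Local Open Scope ring_scope.

(* The alphabet is discrete, and A^Z carries the product topology. *)
Definition fullshift (A : finType) : topologicalType :=
  {ptws int -> discrete_topology A}.

Definition shift (A : finType) (x : fullshift A) : fullshift A :=
  fun i : int => x (i + 1).

Definition is_subshift (A : finType) (X : set (fullshift A)) : Prop :=
  closed X /\ @shift A @` X = X.

Definition word_occurs (A : finType) (w : seq A) (x : fullshift A) : Prop :=
  exists i : int, mkseq (fun k => x (i + k%:Z)) (size w) = w.

Definition ray_occurs (A : finType) (r : nat -> A) (x : fullshift A) : Prop :=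
  exists i : int, forall k : nat, x (i + k%:Z) = r k.

(* The right-infinite word ws: beyond the end of w, [nth] returns its default
   value, here s (k - size w). *)
Definition catray (A : finType) (w : seq A) (s : nat -> A) : nat -> A :=
  fun k => nth (s (k - size w)%N) w k.

Definition language (A : finType) (X : set (fullshift A)) : set (seq A) :=
  [set w | exists2 x, X x & word_occurs w x].

Definition language_n (A : finType) (X : set (fullshift A)) (n : nat) :
    set (seq A) :=
  language X `&` [set w | size w = n].

Definition follower_set (A : finType) (X : set (fullshift A)) (w : seq A) :
    set (nat -> A) :=
  [set s | exists2 x, X x & ray_occurs (catray w s) x].

Definition follower_sets (A : finType) (X : set (fullshift A)) (n : nat) :
    set (set (nat -> A)) :=
  follower_set X @` language_n X n.

(* [fset_set] is only meaningful on finite sets, so that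
   #|` fset_set (follower_sets X n)| is the number of follower sets. *)
Lemma finite_follower_sets (A : finType) (X : set (fullshift A)) (n : nat) :
  finite_set (follower_sets X n).
Proof.
apply: finite_image.
apply: (@sub_finite_set _ _ ((@tval n A) @` [set: n.-tuple A])).
  by move=> w [_ /= /eqP sz]; exists (Tuple sz).
exact/finite_image/finite_finset.
Qed.

Definition is_sft (A : finType) (X : set (fullshift A)) : Prop :=
  exists S : seq (seq A),
    X = [set x | forall w, w \in S -> ~ word_occurs w x].

(* Since f is only constrained on Y, it stands for a map Y -> A^Z. *)
Definition is_sofic (A : finType) (X : set (fullshift A)) : Prop :=
  exists (B : finType) (Y : set (fullshift B)) (f : fullshift B -> fullshift A),
    [/\ is_sft Y,
        {within Y, continuous f},
        (forall y, Y y -> f (shift y) = shift (f y)) &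
        f @` Y = X].

Definition log2 (R : realType) (x : R) : R := ln x / ln 2.

(* Main.v *)
(* The n + 1 prefixes of a word w of length n have follower sets that are unions
   of nonempty subfamilies of F_X(n). With k = |F_X(n)| and 2^k <= n + 1 there
   are only 2^k - 1 < n + 1 such unions, so two prefixes of w share a follower
   set, and the letters between their ends can be deleted from any extension of
   w without changing its follower set. Hence every follower set is already the
   follower set of a word of length at most n, and there are finitely many.

   A subshift with finitely many follower sets is a factor of the SFT of
   bi-infinite paths in its follower set graph. The path lifting x has as its
   vertex at i the eventual value, as m grows, of F(x_{i-m} ... x_{i-1}), which
   decreases with m and takes finitely many values. *)
Require Import Defs.
From mathcomp Require Import finmap.
From mathcomp Require Import all_boot all_order all_algebra.
From mathcomp Require Import all_classical all_reals all_analysis.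
From mathcomp Require Import zify.

Import Order.TTheory GRing.Theory Num.Theory.
Local Open Scope classical_set_scope.
Local Open Scope ring_scope.

(** * Topology of the full shift *)

(** The product topology is the supremum of those induced by the coordinate projections, so
    convergence can be tested one coordinate at a time. *)
Lemma fullshift_cvg (A : finType) (F : set_system (fullshift A))
    (x : fullshift A) :
  Filter F -> (forall i, \forall y \near F, y i = x i) -> F --> x.
Proof.
move=> FF Fx; apply/cvg_sup => i P.
rewrite nbhsE => -[_ [[C _ <-] /= Cx] CP].
by apply: filterS (Fx i) => y yxi; apply: CP; rewrite /= /proj yxi.
Qed.

Lemma near_coordinate (A : finType) (x : fullshift A) (i : int) :
  \forall y \near x, y i = x i.
Proof.
have := @proj_continuous int (fun=> discrete_topology A) i x.
by move=> /(_ [set x i]); apply; apply/principal_filterP.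
Qed.

Definition one_block_map (A B : finType) (g : B -> A) (y : fullshift B) :
  fullshift A := fun i => g (y i).

Lemma one_block_map_continuous (A B : finType) (g : B -> A) :
  continuous (one_block_map A B g).
Proof.
move=> y.
have Fy : Filter (nbhs y) by exact: nbhs_filter.
apply: (fullshift_cvg _ _ _ (@fmap_filter _ _ _ _ Fy)) => i.
by apply: (@filterS _ _ Fy _ _ _ (near_coordinate B y i)) => z /= /(congr1 g).
Qed.

(** * Decreasing sequences in a finite family of sets *)

Lemma finite_nonincreasing_stationary (T : Type) (D : set (set T))
    (g : nat -> set T) :
  finite_set D -> (forall m, D (g m)) ->
  (forall m p, (m <= p)%N -> g p `<=` g m) ->
  exists M, forall m, (M <= m)%N -> g m = g M.
Proof.
move=> finD Dg gN.
pose below m := [fset G in fset_set D | `[< (G `<=` g m)%classic >]]%fset.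
have belowP m G : (G \in below m) = (G \in fset_set D) && `[< G `<=` g m >].
  by rewrite !inE.
have gD m : g m \in fset_set D by rewrite in_fset_set // mem_set.
(* [g] is constant from the index that minimizes the number of members of [D]
   below [g m]. *)
have exC : exists c, `[< exists m, c = #|` below m| >].
  by exists #|` below 0%N|; apply/asboolP; exists 0%N.
have [_ /asboolP[M ->] Mmin] := ex_minnP exC.
exists M => m Mm; apply/seteqP; split; first exact: gN.
have MM : g M \in below M by rewrite belowP gD; apply/asboolP.
(* The family [below m] is contained in [below M] and, by minimality, has no fewer members, so the
   two coincide. *)
suff bmM : below m = below M.
  by move: MM; rewrite -bmM belowP => /andP[_ /asboolP].
apply/eqP; rewrite eqEfcard Mmin ?andbT; last by apply/asboolP; exists m.
apply/fsubsetP => G; rewrite !belowP => /andP[-> /asboolP Gm].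
by apply/asboolP => s /Gm; apply: gN.
Qed.

(** * Words, rays and their follower sets *)

Section Words.
Context {A : finType}.
Implicit Types (X : set (fullshift A)) (x : fullshift A) (u v w : seq A).
Implicit Types (r s : nat -> A) (i : int) (m n : nat).

Definition window x i m : seq A := mkseq (fun k => x (i + k%:Z)) m.

Lemma size_window x i m : size (window x i m) = m.
Proof. exact: size_mkseq. Qed.

Lemma windowD x i m n :
  window x i (m + n) = window x i m ++ window x (i + m%:Z) n.
Proof.
rewrite /window /mkseq iotaD map_cat add0n; congr (_ ++ _).
rewrite -[in LHS](addn0 m) iotaDl -map_comp; apply: eq_map => k /=.
by rewrite PoszD addrA.
Qed.

Lemma windowS x i m : window x i m.+1 = rcons (window x i m) (x (i + m%:Z)).
Proof. by rewrite -addn1 windowD -cats1 /window /mkseq /= addr0. Qed.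

Lemma catray_nil s : catray [::] s = s.
Proof. by apply/funext => k; rewrite /catray nth_nil subn0. Qed.

Lemma catray_cat u v s : catray (u ++ v) s = catray u (catray v s).
Proof.
apply/funext => k; rewrite /catray nth_cat size_cat.
case: ltnP => ku; first exact: set_nth_default.
by rewrite [RHS]nth_default // subnDA.
Qed.

Lemma catray_ge u s k : catray u s (size u + k)%N = s k.
Proof. by rewrite /catray nth_default ?leq_addr // addKn. Qed.

Lemma catray_window x i m :
  catray (window x i m) (fun k => x (i + (m + k)%N%:Z)) =
  (fun k => x (i + k%:Z)).
Proof.
apply/funext => k; rewrite /catray size_window.
have [km|mk] := ltnP k m; first by rewrite nth_mkseq.
by rewrite nth_default ?size_window // subnKC.
Qed.

Lemma window_catray x i u s :
  (forall k, x (i + k%:Z) = catray u s k) -> window x i (size u) = u.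
Proof.
move=> xus; apply: (@eq_from_nth _ (x 0)); rewrite ?size_window // => k ku.
by rewrite nth_mkseq // xus; apply: set_nth_default.
Qed.

(** The analogue for rays of the Brzozowski derivative of a language; it gives the transitions of
    the follower set graph. *)
Definition ray_derivative u (G : set (nat -> A)) : set (nat -> A) :=
  [set s | G (catray u s)].

Lemma ray_derivative_nil (G : set (nat -> A)) : ray_derivative [::] G = G.
Proof. by apply/seteqP; split=> s; rewrite /ray_derivative /= catray_nil. Qed.

Lemma ray_derivative_cat u v (G : set (nat -> A)) :
  ray_derivative (u ++ v) G = ray_derivative v (ray_derivative u G).
Proof. by rewrite /ray_derivative; under eq_set do rewrite catray_cat. Qed.

Lemma follower_set_cat X u v :
  follower_set X (u ++ v) = ray_derivative v (follower_set X u).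
Proof.
by rewrite /follower_set /ray_derivative; under eq_set do rewrite catray_cat.
Qed.

Lemma follower_set_window X x i m : X x ->
  follower_set X (window x i m) (fun k => x (i + (m + k)%N%:Z)).
Proof. by move=> Xx; exists x => //; exists i => k; rewrite catray_window. Qed.

Lemma language_window X x i m : X x -> language X (window x i m).
Proof. by move=> Xx; exists x => //; exists i; rewrite size_window. Qed.

Lemma languageP X w : language X w <-> follower_set X w !=set0.
Proof.
split=> [[x Xx [i <-]]|[s [x Xx [i xws]]]].
  by eexists; apply: follower_set_window.
by exists x => //; exists i; apply: window_catray xws.
Qed.

Lemma follower_set_suffix X u v : follower_set X (u ++ v) `<=` follower_set X v.
Proof.
move=> s [x Xx [i xuvs]]; exists x => //; exists (i + (size u)%:Z) => k.
by rewrite -addrA -PoszD xuvs catray_cat catray_ge.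
Qed.

(** Points are two-sided, so [m] more letters can be read to the left of any occurrence of [us]. *)
Lemma follower_set_extend_left X u s m : follower_set X u s ->
  exists2 v, size v = m & follower_set X (v ++ u) s.
Proof.
move=> [x Xx [i xus]]; exists (window x (i - m%:Z) m); first exact: size_window.
exists x => //; exists (i - m%:Z) => k; rewrite catray_cat.
(* The ray of [x] from [i - m] is a word of [m] letters followed by the ray from [i], which is
   [us]. *)
rewrite -[LHS](congr1 (fun r => r k) (catray_window x (i - m%:Z) m)).
congr catray; apply/funext => l.
by rewrite PoszD addrA subrK xus.
Qed.

(** A ray that follows [u] also follows some word [vu] of length [n], and lengthening a word on the
    left only shrinks its follower set. *)
Lemma follower_set_bigcup X n u : (size u <= n)%N ->
  follower_set X u =
  \bigcup_(G in follower_sets X n `&` [set G | G `<=` follower_set X u]) G.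
Proof.
move=> un; apply/seteqP; split=> [s us|s [G [_ Gu] /Gu]//].
have [v sv vus] := follower_set_extend_left X u s (n - size u) us.
exists (follower_set X (v ++ u)) => //; split; last exact: follower_set_suffix.
exists (v ++ u) => //; split; last by rewrite /= size_cat sv subnK.
by apply/languageP; exists s.
Qed.

End Words.

Section Subshift.
Context {A : finType}.
Implicit Types (X : set (fullshift A)) (x : fullshift A).

(** * Translates and language of a subshift *)

Lemma subshift_translate X x (j : int) : is_subshift X -> X x ->
  X (fun i => x (i + j)).
Proof.
move=> [_ shiftX]; have shX z : X z -> X (Defs.shift z).
  by move=> Xz; rewrite -shiftX; exists z.
(* The shift maps [X] onto itself, so a point of [X] is the shift of some [t] in [X]; shifting back
   returns [t]. *)
have unshX z : X z -> X (fun i => z (i - 1)).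
  rewrite -{1}shiftX => -[t Xt <-].
  rewrite (_ : (fun i => _) = t) //; apply/funext => i.
  by rewrite /Defs.shift subrK.
elim: j x => [|n IH|n IH] x Xx.
- by rewrite (_ : (fun i => _) = x) //; apply/funext => i; rewrite addr0.
- rewrite (_ : (fun i => _) = (fun i => Defs.shift x (i + n%:Z))).
    exact/IH/shX.
  by apply/funext => i; rewrite /Defs.shift intS -addrA (addrC 1).
- pose z : fullshift A := fun i => x (i - 1).
  rewrite (_ : (fun i => _) = (fun i => z (i + - n%:Z))).
    exact/IH/unshX.
  by apply/funext => i; rewrite /z intS opprD -addrA (addrC (-1)).
Qed.

(** Such an [x] is a limit of points [z m] of [X] that agree with [x] on [[-m, m]], and [X] is
    closed. *)
Lemma subshift_language X x : is_subshift X ->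
  (forall i m, language X (window x i m)) -> X x.
Proof.
move=> subX Lx.
have /choice[z zP] : forall m : nat, exists z : fullshift A, X z /\
    forall i : int, (`|i| <= m)%N -> z i = x i.
  move=> m; have [z Xz [j]] := Lx (- m%:Z) m.*2.+1.
  rewrite size_window => zx.
  (* This translation moves the occurrence at [j] to position [-m]. *)
  exists (fun i => z (i + (j + m%:Z))); split.
    exact: (subshift_translate _ _ (j + m%:Z) subX Xz).
  move=> i im; have [k kE] : exists k : nat, i = - m%:Z + k%:Z.
    by exists (absz (i + m%:Z)); lia.
  have km : (k < m.*2.+1)%N by lia.
  have := congr1 (fun w => nth (x 0) w k) zx.
  by rewrite !nth_mkseq // -kE => <-; congr z; lia.
apply: (@closed_cvg nat (fullshift A) \oo _ z X subX.1).
  by apply: nearW => m; case: (zP m).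
apply: fullshift_cvg => i; exists `|i|%N => // m /= im.
by have [_] := zP m; apply.
Qed.

(** * The follower set graph and its path shift *)

Section FollowerPresentation.
Context (X : set (fullshift A)).
Context (finX : finite_set (follower_set X @` language X)).

Let state := fset_set (follower_set X @` language X).
(** A vertex is paired with the letter of the edge leaving it, so that paths are cut out by a
    condition on adjacent symbols. *)
Let label : finType := (state * A)%type.

Let stateP (q : state) : exists2 w, language X w & follower_set X w = val q.
Proof. by have := fsvalP q; rewrite in_fset_set // => /set_mem. Qed.

Let edge (b c : label) : bool :=
  `[< val c.1 = ray_derivative [:: b.2] (val b.1) >].

Definition follower_presentation : set (fullshift label) :=
  [set y | forall i, edge (y i) (y (i + 1))].

Lemma follower_presentation_sft : is_sft follower_presentation.
Proof.
exists [seq [:: b.1; b.2] | b <- enum {: label * label} & ~~ edge b.1 b.2].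
apply/seteqP; split=> y yP.
  move=> _ /mapP[[b c] + ->] [i [yb yc]].
  by rewrite mem_filter /= -yb -yc addr0 yP.
move=> i; apply/negPn/negP => ne.
apply: (yP [:: y i; y (i + 1)]).
  by apply/mapP; exists (y i, y (i + 1)); rewrite // mem_filter ne mem_enum.
by exists i; rewrite /mkseq /= addr0.
Qed.

Let label_factor : fullshift label -> fullshift A := one_block_map A label snd.

Lemma follower_presentation_path y i m : follower_presentation y ->
  val (y (i + m%:Z)).1 =
  ray_derivative (window (label_factor y) i m) (val (y i).1).
Proof.
move=> yP; elim: m => [|m IH]; first by rewrite addr0 ray_derivative_nil.
rewrite windowS -cats1 ray_derivative_cat -IH -addn1 PoszD addrA.
exact/asboolP/yP.
Qed.

Lemma label_factor_follower_presentation : is_subshift X ->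
  label_factor @` follower_presentation = X.
Proof.
move=> subX; apply/seteqP; split=> [_ [y yP <-]|x Xx].
  apply: subshift_language => // i m.
  (* Vertices are nonempty sets, as follower sets of words of the language. A ray at the end vertex,
     preceded by the labels of the path, is a ray at the start vertex. *)
  have [w _ wE] := stateP (y i).1; have [v Lv vE] := stateP (y (i + m%:Z)).1.
  have [s] := (languageP _ _).1 Lv.
  rewrite vE follower_presentation_path // -wE => /= ws.
  apply/languageP; exists s; apply: (follower_set_suffix X w).
  by rewrite follower_set_cat.
pose past i m := window x (i - m%:Z) m.
have pastS i m : past (i + 1) m.+1 = past i m ++ [:: x i].
  by rewrite /past windowS -cats1; congr (window _ _ _ ++ [:: x _]); lia.
have past_decr i m p : (m <= p)%N ->
    follower_set X (past i p) `<=` follower_set X (past i m).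
  move=> mp; rewrite /past -{2}(subnK mp) windowD.
  rewrite (_ : i - p%:Z + (p - m)%N%:Z = i - m%:Z); last lia.
  exact: follower_set_suffix.
have /choice[q qP] i : exists q : state,
    exists M, forall m, (M <= m)%N -> follower_set X (past i m) = val q.
  have pastX m : (follower_set X @` language X) (follower_set X (past i m)).
    by exists (past i m) => //; apply: language_window.
  have [M ME] := finite_nonincreasing_stationary _ _ _ finX pastX (past_decr i).
  have qM : follower_set X (past i M) \in state.
    by rewrite in_fset_set // mem_set.
  by exists [` qM]%fset, M.
exists (fun i => (q i, x i)) => // i; apply/asboolP => /=.
have [M ME] := qP i; have [M' ME'] := qP (i + 1).
(* Pasts of lengths [N] at [i] and [N + 1] at [i + 1] start at the same position and differ by the
   last letter [x i]. *)
rewrite -(ME (maxn M M')) ?leq_maxl // -(ME' (maxn M M').+1) ?leqW ?leq_maxr //.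
by rewrite pastS follower_set_cat.
Qed.

Lemma finite_follower_sets_sofic : is_subshift X -> is_sofic X.
Proof.
move=> subX; exists label, follower_presentation, label_factor; split=> //.
- exact: follower_presentation_sft.
- exact: continuous_subspaceT (one_block_map_continuous A label snd).
- exact: label_factor_follower_presentation.
Qed.

End FollowerPresentation.

(** * Pumping and finiteness of the follower sets *)

Lemma few_follower_sets_pumping X n w :
  (2 ^ #|` fset_set (follower_sets X n)| <= n.+1)%N ->
  language X w -> (n <= size w)%N ->
  exists i j, (i < j <= n)%N /\
    follower_set X (take i w) = follower_set X (take j w).
Proof.
set K := fset_set _ => cardK Lw nw.
have take_le (i : 'I_n.+1) : (size (take i w) <= n)%N.
  by rewrite size_take_min (leq_trans (geq_minl _ _)) // -ltnS.
have inK G : (G \in K) <-> follower_sets X n G.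
  rewrite in_fset_set; last exact: finite_follower_sets.
  by split=> [/set_mem|/mem_set].
(* The largest subfamily with the required union serves as a canonical choice; it determines the
   follower set of the prefix. *)
pose below (i : 'I_n.+1) :=
  [set G : K | `[< (val G `<=` follower_set X (take i w))%classic >]]%SET.
have follower_below (i : 'I_n.+1) : follower_set X (take i w) =
    \bigcup_(G in [set G : K | G \in below i]) val G.
  apply/seteqP; split=> s; last first.
    by move=> [G]; rewrite /= inE => /asboolP Gi /Gi.
  rewrite (follower_set_bigcup _ _ _ (take_le i)) => -[G [KG Gi] Gs].
  by exists [` (inK G).2 KG]%fset => //=; rewrite inE; apply/asboolP.
(* An empty family would make the follower set of the prefix empty, although the prefix extends to
   [w] in the language. *)
have below_neq0 (i : 'I_n.+1) : below i != finset.set0.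
  apply/negP => /eqP i0.
  have [s ws] := (languageP _ _).1 Lw.
  move: ws; rewrite -[w](cat_take_drop i) follower_set_cat /ray_derivative /=.
  by rewrite follower_below i0 => -[G]; rewrite /= inE.
(* Pigeonhole: [n + 1] prefixes, but at most [n] nonempty subfamilies. *)
have /injectivePn[i [j ij bij]] : ~~ injectiveb below.
  apply/negP => /injectiveP inj_below.
  have : (#|below @: [set: 'I_n.+1]%SET| <=
          #|[set~ (finset.set0 : {set K})]%SET|)%N.
    by apply/subset_leq_card/fintype.subsetP => _ /imsetP[i _ ->]; rewrite !inE.
  rewrite card_imset // cardsT card_ord cardsC1 -cardsT -powersetT.
  by rewrite card_powerset cardsT -cardfE; lia.
wlog lt_ij : i j ij bij / (i < j)%N.
  move=> H; have [|ji|/val_inj ijE] := ltngtP i j; first exact: H.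
    by apply: (H j i); rewrite // eq_sym.
  by rewrite ijE eqxx in ij.
exists i, j; rewrite lt_ij -ltnS ltn_ord; split=> //.
by rewrite !follower_below bij.
Qed.

Lemma pumping_follower_set_shorter X n w :
  (2 ^ #|` fset_set (follower_sets X n)| <= n.+1)%N -> language X w ->
  exists2 u : seq A, (size u <= n)%N & follower_set X u = follower_set X w.
Proof.
move=> cardK; have [m] := ubnP (size w); elim: m w => // m IH w; rewrite ltnS.
move=> wm Lw; have [wn|nw] := leqP (size w) n; first by exists w.
have [i [j [/andP[ij jn] Eij]]] :=
  few_follower_sets_pumping _ _ _ cardK Lw (ltnW nw).
(* Both sides are the derivative by [drop j w] of the same set. *)
have E : follower_set X (take i w ++ drop j w) = follower_set X w.
  by rewrite follower_set_cat Eij -follower_set_cat cat_take_drop.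
have [||u un uE] := IH (take i w ++ drop j w); last by exists u; rewrite // uE.
  by rewrite size_cat size_drop size_takel; lia.
by apply/languageP; rewrite E; apply/languageP.
Qed.

Lemma few_follower_sets_finite X n :
  (2 ^ #|` fset_set (follower_sets X n)| <= n.+1)%N ->
  finite_set (follower_set X @` language X).
Proof.
move=> cardK.
apply: (@sub_finite_set _ _ ((fun u : n.-bseq A => follower_set X u) @` setT)).
  move=> _ [w Lw <-].
  have [u un <-] := pumping_follower_set_shorter _ _ _ cardK Lw.
  by exists (Bseq un).
exact/finite_image/finite_finset.
Qed.

End Subshift.

(** * From the logarithmic bound to the conclusion *)

(** Multiplying by [ln 2 > 0] reduces the comparison to [ln (2 ^ k) <= ln m], and [ln] is increasing
    on positive reals. *)
Lemma le_log2 (R : realType) (k m : nat) : (0 < m)%N ->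
  (k%:R <= log2 (m%:R : R)) = (2 ^ k <= m)%N.
Proof.
move=> m0; rewrite /log2 ler_pdivlMr ?ln_gt0 ?ltr1n // mulr_natl -lnXn //.
by rewrite ler_ln ?posrE ?exprn_gt0 ?ltr0n // -natrX ler_nat.
Qed.

Theorem theorem4p7 (R : realType) (A : finType) (X : set (fullshift A)) :
  is_subshift X ->
  (exists2 n : nat, (0 < n)%N &
     #|` fset_set (follower_sets X n)|%:R <= log2 (n%:R + 1 : R)) ->
  is_sofic X.
Proof.
move=> subX [n _]; rewrite natr1 le_log2 // => cardK.
exact: finite_follower_sets_sofic (few_follower_sets_finite _ _ cardK) subX.
Qed.
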